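(* Let $k\geq 2$ and $n\geq 3$ be integers, and let $C_{n,k}$ be any graph obtained from the cycle $C_n$ by attaching at least $2$ and at most $k$ pendant vertices to each vertex of $C_n$. Then \[\log_2(n)+1\leq \operatorname{Z}_2(C_{n,k})\leq \log_2(n-2)+2k+1.\]
   Context: Graphs are finite, simple and undirected. The number of pendant (degree-one) vertices attached may vary from one cycle vertex to another. The $\operatorname{Z}_q$-forcing game ($q\ge 0$ an integer) is played on a graph $G$ by two players, Blue (who has tokens) and White. All vertices of $G$ are initially white. Blue repeatedly applies one of the following rules until all vertices are blue. Rule 1: for one token, Blue can change any vertex from white to blue. Rule 2: at no cost, if a blue vertex $v$ of $G$ has exactly one white neighbor $w$, Blue may turn $w$ blue. Rule 3: let $B$ be the current set of blue vertices and let $W_1,\dots,W_r$ be the vertex sets of the connected components of $G[V(G)\setminus B]$. Blue selects at least $q+1$ of the $W_i$ and announces the selection to White (so this rule needs $r\ge q+1$). White then selects a nonempty subset $\{W_{i_1},\dots,W_{i_\ell}\}$ of the announced components and announces it back to Blue. At no cost, Blue can apply Rule 2 on the induced subgraph $G[B\cup W_{i_1}\cup\cdots\cup W_{i_\ell}]$. The $\operatorname{Z}_q$-forcing number $\operatorname{Z}_q(G)$ is the fewest number of tokens Blue must spend to color all of $G$ blue, under adversarial play by White. *)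

(* Defs.v *)
From HB Require Import structures.
From mathcomp Require Import all_boot all_order all_algebra.
From mathcomp Require Import boolp reals exp.

Set Implicit Arguments.
Unset Strict Implicit.
Unset Printing Implicit Defensive.

Import Order.TTheory GRing.Theory Num.Theory.

Record sgraph := SGraph {
  vertex :> finType;
  adj : rel vertex;
  adj_sym : symmetric adj;
  adj_irrefl : irreflexive adj
}.

Section Game.
Variable G : sgraph.
Implicit Types (B U W : {set G}) (v w : G) (S T : {set {set G}}) (q t : nat).

(* One application of Rule 2 in the induced subgraph G[U], turning the blue
   set B into B'. *)
Definition rule2 U B B' : Prop :=
  exists v w, [/\ v \in U :&: B,
                  [set x in U :\: B | adj v x] = [set w]
                & B' = w |: B].

Definition white_adj B : rel G :=
  [rel x y | [&& x \notin B, y \notin B & adj x y]].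

(* The vertex sets of the connected components of G[V(G) \ B]. *)
Definition white_components B : {set {set G}} :=
  [set [set y | connect (white_adj B) x y] | x in ~: B].

(* [blue_wins q t B]: from the position with blue set B, Blue has a strategy
   that colors all of G blue, whatever White does, spending at most t tokens.
   In Rule 3, S is Blue's announcement, T is White's reply and [next T] is the
   blue set after Blue's application of Rule 2 against the reply T. Declining
   to apply Rule 2 would only repeat the same position, so the inductive
   definition needs no case for it. *)
Inductive blue_wins q : nat -> {set G} -> Prop :=
| BlueDone t : blue_wins q t setT
| BlueToken t B v :
    v \notin B -> blue_wins q t (v |: B) -> blue_wins q t.+1 B
| BlueForce t B B' :
    rule2 setT B B' -> blue_wins q t B' -> blue_wins q t B
| BlueAnnounce t B S (next : {set {set G}} -> {set G}) :
    S \subset white_components B -> q.+1 <= #|S| ->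
    (forall T, T \subset S -> T != set0 -> rule2 (B :|: cover T) B (next T)) ->
    (forall T, T \subset S -> T != set0 -> blue_wins q t (next T)) ->
    blue_wins q t B.

Lemma blue_wins_tokens q : exists t, `[< blue_wins q t set0 >].
Proof.
suff H t B : #|~: B| = t -> blue_wins q t B.
  by exists #|~: (set0 : {set G})|; apply/asboolP; exact: H.
elim: t B => [|t IHt] B cB.
  suff -> : B = setT by exact: BlueDone.
  by rewrite -[B]setCK (cards0_eq cB) setC0.
have /card_gt0P[v vB] : 0 < #|~: B| by rewrite cB.
apply: (@BlueToken q t B v); first by rewrite -in_setC.
apply: IHt; move: cB; rewrite (cardsD1 v (~: B)) vB add1n => -[<-].
by rewrite setCU setIC -setDE.
Qed.

Definition Zq q : nat := ex_minn (blue_wins_tokens q).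

End Game.

Section Cycle.
Variable n : nat.

(* ordS is the successor modulo n; this is the n-cycle for n >= 3, and the
   condition i != j only matters for n = 1. *)
Definition cycle_adj : rel 'I_n :=
  [rel i j | (i != j) && ((j == ordS i) || (i == ordS j))].

Lemma cycle_adj_sym : symmetric cycle_adj.
Proof. by move=> i j; rewrite /cycle_adj /= eq_sym orbC. Qed.

Lemma cycle_adj_irrefl : irreflexive cycle_adj.
Proof. by move=> i; rewrite /cycle_adj /= eqxx. Qed.

Definition cycle_graph := SGraph cycle_adj_sym cycle_adj_irrefl.

End Cycle.

Section Pendants.
Variables (G : sgraph) (p : G -> nat).

Definition pendant_vertex : finType := (G + {v : G & 'I_(p v)})%type.

Definition pendant_adj : rel pendant_vertex := fun x y =>
  match x, y with
  | inl u, inl v => adj u v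
  | inl u, inr l => u == tag l
  | inr l, inl u => u == tag l
  | inr _, inr _ => false
  end.

Lemma pendant_adj_sym : symmetric pendant_adj.
Proof. by move=> [u|l] [v|m] //=; exact: adj_sym. Qed.

Lemma pendant_adj_irrefl : irreflexive pendant_adj.
Proof. by move=> [u|l] //=; exact: adj_irrefl. Qed.

(* G with p v pendant vertices attached to each vertex v. *)
Definition attach_pendants := SGraph pendant_adj_sym pendant_adj_irrefl.

End Pendants.

Definition log2 (R : realType) (x : R) : R := (ln x / ln 2)%R.

(* Main.v *)
Require Import Defs.
From HB Require Import structures.
From mathcomp Require Import all_boot all_order all_algebra zify.
From mathcomp Require Import boolp reals exp.

Import Order.TTheory GRing.Theory Num.Theory.

(** Both bounds come from the same fact: a token splits a white stretch of the
    cycle in two, and White can make Blue keep the longer part.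

    Lower bound.  Call an arc of [j] cycle vertices guarded when it is white with
    all its leaves and each of its two ends (distinct cycle vertices, white or
    blue) still has a white leaf.  An end then sees two white vertices, its leaf
    and its neighbor in the arc, so it cannot force.  White keeps the arc guarded
    through every announcement ([white_reply]): he returns a component away from
    the guarded zone, or two leaves of the same vertex, or, when neither is
    announced, the arc together with one leaf of each end, and these three leave
    Blue no move.  So only tokens matter.  A token in the star of an arc vertex leaves
    two guarded arcs, because that vertex had two white leaves; a token at a leaf of an
    end shortens the arc by one.  Hence [j < 2 ^ t] if Blue wins with [t] tokens
    ([guarded_arc_bound]).  In the opening all tokens lie in the star of a single
    cycle vertex [a]; both ends of the white arc are then [a], and a separate count
    gives [n <= 2 ^ t], where [t] does not include the first token.

    Upper bound.  Blue colors the vertices [0] and [n - 1] and then always the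
    middle of the remaining white arc.  Between two such tokens she announces both
    white arcs and a leaf at the outer end of the left one, which makes progress
    whatever White returns, until one of the arcs is blue ([two_arcs_win]).  After
    at most [trunc_log 2 (n - 2) + 1] of these tokens the cycle is blue.  While three
    cycle vertices have white leaves, announcing one leaf at each is free progress;
    when only two are left, they cost at most [k - 1] tokens each
    ([finish_leaves]). *)

Set Implicit Arguments.
Unset Strict Implicit.
Unset Printing Implicit Defensive.

(** * Forcing moves and white components in an arbitrary graph *)

Section GameTheory.
Variable G : sgraph.
Implicit Types (B U : {set G}) (v w x y : G) (S T : {set {set G}}).

Lemma rule2_intro U B v w :
    v \in U -> v \in B -> w \in U -> w \notin B -> adj v w ->
    (forall x, x \in U -> x \notin B -> adj v x -> x = w) ->
  rule2 U B (w |: B).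
Proof.
move=> vU vB wU wB vw uniq_w; exists v, w; split=> //; first by rewrite inE vU.
apply/setP=> x; rewrite !inE -andbA.
apply/and3P/eqP => [[xB xU vx] | ->]; first exact: uniq_w.
by rewrite wU wB vw.
Qed.

Lemma rule2_elim U B B' : rule2 U B B' ->
  exists v w, [/\ v \in B, w \in U, w \notin B, adj v w & B' = w |: B] /\
    (forall x, x \in U -> x \notin B -> adj v x -> x = w).
Proof.
move=> [v [w [/setIP[_ vB] /setP eqw ->]]]; exists v, w.
have := eqw w; rewrite !inE eqxx => /andP[/andP[wB wU] vw].
split=> // x xU xB vx; have := eqw x.
by rewrite !inE xU xB vx => /esym/eqP.
Qed.

Lemma white_adj_sym B : symmetric (white_adj B).
Proof. by move=> x y; rewrite /white_adj /= adj_sym andbCA. Qed.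

Lemma connect_white_sym B : connect_sym (white_adj B).
Proof. exact/sym_connect_sym/white_adj_sym. Qed.

Lemma connect_closed B (A : G -> Prop) x y :
    (forall u v, A u -> u \notin B -> v \notin B -> adj u v -> A v) ->
  A x -> connect (white_adj B) x y -> A y.
Proof.
move=> clA Ax /connectP[s]; elim: s x Ax => [|z s IHs] x Ax /=; first by move=> _ ->.
by case/andP=> /and3P[xB zB xz]; apply: IHs; apply: clA xz.
Qed.

Definition white_comp B x : {set G} := [set y | connect (white_adj B) x y].

Lemma mem_white_comp B x : x \in white_comp B x.
Proof. by rewrite inE connect0. Qed.

Lemma eq_white_comp B x y :
  connect (white_adj B) x y -> white_comp B x = white_comp B y.
Proof.
by move=> xy; apply/setP=> z; rewrite !inE (same_connect (@connect_white_sym B) xy).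
Qed.

Lemma adj_white_comp B x y : x \notin B -> y \notin B -> adj x y ->
  white_comp B x = white_comp B y.
Proof. by move=> xB yB xy; apply/eq_white_comp/connect1/and3P. Qed.

Lemma white_comp_white B x y : x \notin B -> y \in white_comp B x -> y \notin B.
Proof.
by rewrite inE => xB; apply: (@connect_closed B (fun z => z \notin B)).
Qed.

Lemma white_comp_in B x : x \notin B -> white_comp B x \in white_components B.
Proof. by move=> xB; apply: imset_f; rewrite inE. Qed.

Lemma white_componentsP B (C : {set G}) x :
    C \in white_components B -> x \in C -> x \notin B /\ C = white_comp B x.
Proof.
case/imsetP=> y; rewrite inE => yB -> xC; split.
  by apply: white_comp_white xC.
by apply: eq_white_comp; rewrite inE in xC.
Qed.

Lemma white_comp_singleton B x : (forall y, adj x y -> y \in B) ->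
  white_comp B x = [set x].
Proof.
move=> xB; apply/setP=> y; rewrite !inE; apply/idP/eqP => [|->]; last exact: connect0.
move=> xy; apply: (@connect_closed B (eq^~ x)) xy => // u v -> _ vB /xB.
by rewrite (negPf vB).
Qed.

(** [BlueAnnounce] with the answer to each reply chosen afterwards. *)
Lemma blue_wins_announce q t B S :
    S \subset white_components B -> q < #|S| ->
    (forall T, T \subset S -> T != set0 ->
       exists2 B', rule2 (B :|: cover T) B B' & blue_wins q t B') ->
  blue_wins q t B.
Proof.
move=> sSW cS winS.
have /choice[next nextP] T : exists B', T \subset S -> T != set0 ->
    rule2 (B :|: cover T) B B' /\ blue_wins q t B'.
  have [TS|/negP nTS] := boolP (T \subset S); last by exists B.
  have [T0|T0] := eqVneq T set0; first by exists B.
  by have [B' ? ?] := winS T TS T0; exists B'.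
by apply: (BlueAnnounce (S := S) (next := next)) => // T TS T0; case: (nextP T TS T0).
Qed.

(** What White needs: a class [P] of positions that White can maintain through
    every free move.  Then only the effect of a token has to be examined. *)
Lemma blue_wins_trap q (P : {set G} -> Prop) (Q : nat -> Prop) :
    ~ P setT ->
    (forall B B', P B -> rule2 setT B B' -> P B') ->
    (forall B S, P B -> S \subset white_components B -> q < #|S| ->
       exists T, [/\ T \subset S, T != set0 &
         forall B', rule2 (B :|: cover T) B B' -> P B']) ->
    (forall t B v, P B -> v \notin B -> blue_wins q t (v |: B) ->
       (P (v |: B) -> Q t) -> Q t.+1) ->
  forall t B, P B -> blue_wins q t B -> Q t.
Proof.
move=> PT Pforce Preply Ptoken t B PB winB.
elim: winB PB => {t B} [t /PT | t B v vB win IH PB | t B B' BB' _ IH PB |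
    t B S next SW cS nextP _ IH PB] //.
- exact: Ptoken IH.
- by apply: IH; apply: Pforce BB'.
have [T [TS T0 TP]] := Preply B S PB SW cS.
by apply: (IH T TS T0); apply: TP; apply: nextP.
Qed.

End GameTheory.

Lemma card_setCU1 (T : finType) (A : {set T}) x :
  x \notin A -> #|~: A| = #|~: (x |: A)|.+1.
Proof.
move=> xA; rewrite (cardsD1 x (~: A)) inE xA add1n; congr _.+1.
by apply: eq_card => y; rewrite !inE negb_or.
Qed.

Lemma card_setU3 (T : finType) (A B C : T) : A != B -> B != C -> C != A ->
  #|[set A; B; C]| = 3.
Proof.
by move=> AB BC CA; rewrite setUC cardsU1 cards2 !inE negb_or CA eq_sym BC AB.
Qed.

(** * Coordinates in a cycle with pendant vertices *)

Section PendantCycle.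
Variables (n : nat) (p : cycle_graph n -> nat).
Hypothesis n_ge3 : 2 < n.
Local Notation G := (attach_pendants p).
Implicit Types (i a : 'I_n) (j k m : nat) (x y v w : G) (B : {set G}).

Definition core x : 'I_n := match x with inl i => i | inr l => tag l end.
Definition center i : G := inl i.
Definition is_leaf x : bool := if x is inr _ then true else false.

Lemma core_center i : core (center i) = i. Proof. by []. Qed.

Lemma nonleafE x : ~~ is_leaf x -> x = center (core x).
Proof. by case: x. Qed.

Lemma adj_center_leaf i x : is_leaf x -> adj (center i) x = (i == core x).
Proof. by case: x. Qed.

Lemma adj_leaf x y : is_leaf x -> adj x y -> y = center (core x).
Proof. by case: x y => [//|l] [i|m] // _ /eqP->. Qed.

Lemma adj_to_leaf x y : is_leaf y -> adj x y -> x = center (core y).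
Proof. by rewrite adj_sym; apply: adj_leaf. Qed.

Lemma adj_core_neq x y : adj x y -> core x != core y ->
  [/\ x = center (core x), y = center (core y) & cycle_adj (core x) (core y)].
Proof. by case: x y => [i|l] [j|m] //= /eqP->; rewrite eqxx. Qed.

Lemma ordS_neq i : i != ordS i.
Proof.
apply/eqP=> /(congr1 val) /= h; have := ltn_ord i; rewrite leq_eqVlt => /orP[/eqP e|lt].
  by move: h; rewrite e modnn; move: n_ge3; lia.
by move: h; rewrite modn_small //; lia.
Qed.

Lemma cycle_adjS i : cycle_adj i (ordS i).
Proof. by rewrite /cycle_adj /= ordS_neq eqxx. Qed.

Lemma cycle_adjP i i' : cycle_adj i i' -> i' = ordS i \/ i = ordS i'.
Proof. by case/andP=> _ /orP[/eqP|/eqP]; [left|right]. Qed.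

Lemma adj_centers i i' : adj (center i) (center i') = cycle_adj i i'.
Proof. by []. Qed.

Lemma val_iter_ordS a k : iter k (@ordS n) a = (a + k) %% n :> nat.
Proof.
elim: k => [|k IHk]; first by rewrite addn0 modn_small.
by rewrite /= IHk -addn1 modnDml addn1 addnS.
Qed.

Lemma iter_ordS_inj a k m : k < n -> m < n ->
  iter k (@ordS n) a = iter m (@ordS n) a -> k = m.
Proof.
move=> kn mn /(congr1 (@nat_of_ord n)); rewrite !val_iter_ordS => /eqP.
by rewrite eqn_modDl !modn_small // => /eqP.
Qed.

Lemma iter_ordS_full a : iter n (@ordS n) a = a.
Proof. by apply/ord_inj; rewrite val_iter_ordS modnDr modn_small. Qed.

Lemma iter_ordS_onto a i : exists2 k, k < n & i = iter k (@ordS n) a.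
Proof.
exists ((i + (n - a)) %% n); first by rewrite ltn_mod; lia.
apply/ord_inj; rewrite val_iter_ordS modnDmr addnCA subnKC ?(ltnW (ltn_ord a)) //.
by rewrite modnDr modn_small.
Qed.

(** * White's strategy *)

Local Notation c a k := (iter k (@ordS n) a).

Definition on_arc a j x : Prop := exists2 k, 0 < k <= j & core x = c a k.

Definition arc_white a j B : Prop := forall x, on_arc a j x -> x \notin B.

Definition leaf_white i B : Prop :=
  exists x, [/\ is_leaf x, core x = i & x \notin B].

(** What has to stay white for an arc to remain guarded; the ends themselves may
    become blue. *)
Definition zone a j x : Prop :=
  on_arc a j x \/ is_leaf x /\ (core x = a \/ core x = c a j.+1).

Lemma on_arc_center a j k : 0 < k <= j -> on_arc a j (center (c a k)).
Proof. by exists k. Qed.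

Lemma not_on_arc a m h k x : core x = c a k -> k < n ->
  h + m < n -> (h + m < k \/ k <= h) -> ~ on_arc (c a h) m x.
Proof. by move=> xk kn hm hk [l lm]; rewrite xk -iterD => /iter_ordS_inj; lia. Qed.

Lemma arc_white_sub a j B m : m <= j -> arc_white a j B -> arc_white a m B.
Proof.
by move=> mj aw x [k /andP[k0 km] e]; apply: aw; exists k => //; rewrite k0 (leq_trans km).
Qed.

Lemma arc_white_shift a j B k m : k + m <= j -> arc_white a j B -> arc_white (c a k) m B.
Proof.
move=> mj aw x [h /andP[h0 hm] e]; apply: aw; exists (h + k); first lia.
by rewrite iterD.
Qed.

Lemma arc_white_add a j B v : ~ on_arc a j v -> arc_white a j B -> arc_white a j (v |: B).
Proof.
move=> nv aw x xa; rewrite !inE negb_or aw // andbT.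
by apply/eqP=> e; apply: nv; rewrite -e.
Qed.

Lemma leaf_white_add i B v : ~ (is_leaf v /\ core v = i) -> leaf_white i B ->
  leaf_white i (v |: B).
Proof.
move=> nv [x [xl xi xB]]; exists x; split=> //; rewrite !inE negb_or xB andbT.
by apply/eqP=> e; apply: nv; rewrite -e.
Qed.

Lemma arc_nbr a j v w : adj v w -> on_arc a j w ->
  on_arc a j v \/
  ~~ is_leaf w /\ (v = center a \/ v = center (c a j.+1)).
Proof.
move=> vw [k /andP[k0 kj] wk].
have [e|neq] := eqVneq (core v) (core w).
  by left; exists k; rewrite ?k0 ?e.
have [vE wE cvw] := adj_core_neq vw neq.
have [m [vm hm]] : exists m, core v = c a m /\ (m = k.+1 \/ m.+1 = k).
  case: (cycle_adjP cvw) => e; last by exists k.+1; rewrite e wk; split=> //; left.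
  exists k.-1; split; last by right; rewrite prednK.
  by apply: ordS_inj; rewrite -e wk -iterS prednK.
have [m0|m0] := posnP m.
  by right; rewrite wE; split=> //; left; rewrite vE vm m0.
have [mj|jm] := leqP m j; first by left; exists m; rewrite ?m0.
right; rewrite wE; split=> //; right; rewrite vE vm.
by have -> : m = j.+1 by lia.
Qed.

Lemma arc_blue_nbr a j B v w : arc_white a j B -> v \in B -> adj v w ->
  on_arc a j w -> ~~ is_leaf w /\ (v = center a \/ v = center (c a j.+1)).
Proof.
by move=> aw vB vw wa; case: (arc_nbr vw wa) => // /aw; rewrite vB.
Qed.

Lemma arc_connected a j B x : arc_white a j B -> 0 < j -> on_arc a j x ->
  white_comp B x = white_comp B (center (c a 1)).
Proof.
move=> aw j0 xa; have xB := aw x xa; case: xa => k /andP[k0 kj] xk.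
have -> : white_comp B x = white_comp B (center (c a k)).
  have [xl|/nonleafE->] := boolP (is_leaf x); last by rewrite xk.
  apply: adj_white_comp => //; first by apply: aw; exists k; rewrite ?k0 ?kj.
  by rewrite adj_sym adj_center_leaf // xk.
elim: k k0 kj {xk} => // -[//|k] IHk _ kj; rewrite -IHk //; last exact: ltnW.
apply: adj_white_comp; last 1 first.
- by rewrite adj_sym; apply: cycle_adjS.
- by apply/aw/on_arc_center.
by apply/aw/on_arc_center; lia.
Qed.

Lemma leaf_white_comp B x : is_leaf x -> x \notin B ->
  white_comp B x = if center (core x) \in B then [set x]
                   else white_comp B (center (core x)).
Proof.
move=> xl xB; case: ifPn => cB.
  by apply: white_comp_singleton => y /(adj_leaf xl)->.
by apply: adj_white_comp => //; rewrite adj_sym adj_center_leaf.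
Qed.

Lemma adj_ends a j : 0 < j -> adj (center a) (center (c a 1)) /\
  adj (center (c a j.+1)) (center (c a j)).
Proof.
by move=> j0; split; [apply: cycle_adjS | rewrite adj_sym; apply: cycle_adjS].
Qed.

Lemma arc_comp_sub a j B x : 0 < j -> arc_white a j B ->
    center a \in B -> center (c a j.+1) \in B ->
  x \in white_comp B (center (c a 1)) -> on_arc a j x.
Proof.
move=> j0 aw aB bB; rewrite inE; apply: (@connect_closed _ _ (on_arc a j)).
  move=> u v ua _ vB uv; have vu : adj v u by rewrite adj_sym.
  case: (arc_nbr vu ua) => // -[_ [e|e]]; first by rewrite e aB in vB.
  by rewrite e bB in vB.
by exists 1; rewrite ?j0.
Qed.

(** If every announced component meets the zone, it is the component [W] of the
    arc or a single leaf of a blue end.  Two announced leaves at the same end are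
    a reply that blocks this end, their only blue neighbor.  Otherwise three
    components can only be [W] and one leaf at each end, the ends being distinct
    and blue; returning all three gives each end two white neighbors. *)
Lemma white_reply a j B (S : {set {set G}}) : 0 < j -> arc_white a j B ->
    S \subset white_components B -> 2 < #|S| ->
  exists T : {set {set G}}, [/\ T \subset S, T != set0 &
    forall B', rule2 (B :|: cover T) B B' ->
      exists2 w, ~ zone a j w & B' = w |: B].
Proof.
move=> j0 aw /subsetP SW cS; set b := c a j.+1; set W := white_comp B (center (c a 1)).
have [[C CS Cz]|meetz] :=
    pselect (exists2 C, C \in S & forall x, x \in C -> ~ zone a j x).
  (* a component away from the zone *)
  exists [set C]; rewrite sub1set CS cover1; split=> //.
    by apply/set0Pn; exists C; rewrite inE.
  move=> B' /rule2_elim[v [w [[_ wU wB _ ->] _]]]; exists w => //.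
  by apply: Cz; move: wU; rewrite inE (negPf wB).
pose leafC x C := [/\ is_leaf x, C = [set x], x \notin B, center (core x) \in B
  & core x = a \/ core x = b].
have compP C : C \in S -> C = W \/ exists x, leafC x C.
  move=> CS; have [x xC xz] : exists2 x, x \in C & zone a j x.
    apply: contrapT => nx; apply: meetz; exists C => // x xC xz.
    by apply: nx; exists x.
  have [xB ->] := white_componentsP (SW C CS) xC.
  case: xz => [xa|[xl xab]]; first by left; apply: (arc_connected aw).
  rewrite (leaf_white_comp xl xB); case: ifPn => cB; first by right; exists x.
  left; case: xab => e; rewrite e in cB *.
    apply: adj_white_comp => //; last by case: (adj_ends a j0).
    by apply/aw/on_arc_center; rewrite j0.
  rewrite /W -(@arc_connected a j B (center (c a j))) //; last first.
    by apply: on_arc_center; rewrite j0 leqnn.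
  apply: adj_white_comp => //; last by case: (adj_ends a j0).
  by apply/aw/on_arc_center; rewrite j0 leqnn.
have [[x [y [[xl yl exy nxy] [xS yS]]]]|nopair] := pselect (exists x y,
    [/\ is_leaf x, is_leaf y, core x = core y & x != y] /\
    ([set x] \in S /\ [set y] \in S)).
  (* two leaves at the same vertex *)
  have xB : x \notin B by case: (white_componentsP (SW _ xS) (set11 x)).
  have yB : y \notin B by case: (white_componentsP (SW _ yS) (set11 y)).
  exists [set [set x]; [set y]]; split.
  - by apply/subsetP=> C; rewrite !inE => /orP[/eqP->|/eqP->].
  - by apply/set0Pn; exists [set x]; rewrite !inE eqxx.
  have -> : cover [set [set x]; [set y]] = [set x; y].
    by rewrite /cover bigcup_setU !big_set1.
  move=> B' /rule2_elim[v [w [[vB wU wB vw _] uniq_w]]].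
  have vE : v = center (core x).
    move: wU vw; rewrite !inE (negPf wB) /=.
    by case/orP=> /eqP-> /adj_to_leaf-> //; rewrite exy.
  case/negP: nxy; apply/eqP; rewrite (uniq_w x) ?inE ?eqxx ?orbT //; last first.
    by rewrite vE adj_center_leaf.
  by rewrite (uniq_w y) ?inE ?eqxx ?orbT // vE adj_center_leaf // exy.
have sep x y C D : C \in S -> D \in S -> C != D -> leafC x C -> leafC y D ->
    core x != core y.
  move=> CS DS nCD [xl xE _ _ _] [yl yE _ _ _]; apply/eqP=> exy; apply: nopair.
  exists x, y; split; last by rewrite -xE -yE.
  by split=> //; apply: contraNneq nCD => exy'; rewrite xE yE exy'.
(* three leaves would have distinct cores among the two ends *)
have WS : W \in S.
  apply: contraT => WS.
  have leafS C : C \in S -> exists x, leafC x C.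
    by move=> CS; case: (compP C CS) => // e; rewrite -e CS in WS.
  have [C [D [E [[CS DS ES] [CD DE EC]]]]] := card_gt2P cS.
  have [x xC] := leafS C CS; have [y yD] := leafS D DS; have [z zE] := leafS E ES.
  move: (sep _ _ _ _ CS DS CD xC yD) (sep _ _ _ _ DS ES DE yD zE)
        (sep _ _ _ _ ES CS EC zE xC).
  case: xC yD zE => _ _ _ _ ex [_ _ _ _ ey] [_ _ _ _ ez].
  by case: ex ey ez => -> [] -> [] ->; rewrite eqxx.
have : 1 < #|S :\ W| by move: cS; rewrite (cardsD1 W S) WS.
case/card_gt1P=> C [D []]; rewrite !inE => /andP[CW CS] /andP[DW DS] CD.
have [x xC] : exists x, leafC x C.
  by case: (compP C CS) => // e; rewrite e eqxx in CW.
have [y yD] : exists y, leafC y D.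
  by case: (compP D DS) => // e; rewrite e eqxx in DW.
have nxy := sep _ _ _ _ CS DS CD xC yD.
case: xC yD => xl xE xB cxB xab [yl yE yB cyB yab]; subst C D.
have leaf_at z : z = a \/ z = b ->
    exists u, [/\ is_leaf u, core u = z, u \notin B & u = x \/ u = y].
  move=> zab; have [e|e] : core x = z \/ core y = z.
  - move: nxy; case: xab yab zab => -> [] -> [] ->; rewrite ?eqxx //; auto.
  - by exists x; split=> //; left.
  - by exists y; split=> //; right.
have aB : center a \in B.
  by have [u [_ <- _ [->|->]]] := leaf_at a (or_introl erefl).
have bB : center b \in B.
  by have [u [_ <- _ [->|->]]] := leaf_at b (or_intror erefl).
have arcW z : on_arc a j z -> z \in W.
  by move=> za; rewrite /W -(arc_connected aw j0 za) mem_white_comp.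
exists [set W; [set x]; [set y]]; split.
- by apply/subsetP=> C; rewrite !inE -orbA => /or3P[] /eqP->.
- by apply/set0Pn; exists W; rewrite !inE eqxx.
have -> : cover [set W; [set x]; [set y]] = W :|: [set x] :|: [set y].
  by rewrite /cover !bigcup_setU !big_set1.
move=> B' /rule2_elim[v [w [[vB wU wB vw _] uniq_w]]]; exfalso.
have [[wl wxy]|[wl vab]] : is_leaf w /\ (w = x \/ w = y) \/
    ~~ is_leaf w /\ (v = center a \/ v = center b).
  move: wU; rewrite !in_setU !in_set1 (negPf wB) /= -orbA => /or3P[wW|/eqP->|/eqP->].
  - by right; apply: (arc_blue_nbr aw vB vw (arc_comp_sub j0 aw aB bB wW)).
  - by left; split=> //; left.
  - by left; split=> //; right.
  (* an end of the arc cannot force its leaf: the arc starts next to it *)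
  have [u [ua uE]] : exists u, on_arc a j u /\ adj v u /\ ~~ is_leaf u.
    have vE : v = center (core w) by apply: adj_to_leaf vw.
    have [e|e] : core w = a \/ core w = b by case: wxy => ->.
    - exists (center (c a 1)); rewrite vE e; split; last by case: (adj_ends a j0).
      by apply: on_arc_center; rewrite j0.
    - exists (center (c a j)); rewrite vE e; split; last by case: (adj_ends a j0).
      by apply: on_arc_center; rewrite j0 leqnn.
  case: uE => vu /negP[]; rewrite (uniq_w u) //; last exact: aw.
  by rewrite !in_setU arcW ?orbT.
(* nor can it force into the arc: one of its leaves is returned too *)
have [u [ul uc uB uxy]] : exists u,
    [/\ is_leaf u, v = center (core u), u \notin B & u = x \/ u = y].
  case: vab => ->; [have := leaf_at a (or_introl erefl) | have := leaf_at b (or_intror erefl)];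
    by case=> u [? e ? ?]; exists u; rewrite e.
move: wl; rewrite -(uniq_w u) ?ul // ?uc ?adj_center_leaf //.
by rewrite !in_setU !in_set1; case: uxy => ->; rewrite eqxx ?orbT.
Qed.

(** A guarded arc is safe from Rule 2 in the whole graph: a blue end sees its white
    leaf and its white neighbor in the arc. *)
Lemma force_off_zone a j B B' : 0 < j -> arc_white a j B ->
    leaf_white a B -> leaf_white (c a j.+1) B -> rule2 setT B B' ->
  exists2 w, ~ zone a j w & B' = w |: B.
Proof.
move=> j0 aw aB bB /rule2_elim[v [w [[vB _ wB vw ->] uniq_w]]]; exists w => //.
have stuck i u : v = center i -> leaf_white i B -> on_arc a j u -> ~~ is_leaf u ->
    adj v u -> False.
  move=> vE [x [xl xi xB]] ua ul vu.
  have xw : x = w by apply: uniq_w => //; rewrite vE adj_center_leaf // xi.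
  by rewrite (uniq_w u) ?inE // -?xw ?xl // in ul; apply: aw.
case=> [wa|[wl wab]].
  have [wl [vE|vE]] := arc_blue_nbr aw vB vw wa; exact: (stuck _ w vE).
have [adja adjb] := adj_ends a j0; move/(adj_to_leaf wl): vw => vE.
case: wab => e; rewrite e in vE.
  by apply: (stuck _ (center (c a 1)) vE) => //;
    [apply: on_arc_center; rewrite j0 | rewrite vE].
by apply: (stuck _ (center (c a j)) vE) => //;
  [apply: on_arc_center; rewrite j0 leqnn | rewrite vE].
Qed.

(** When everything outside the star of [a] is white, [a] cannot force even if
    it has no white leaf, because both of its cycle neighbors are white. *)
Lemma force_off_zone_full a B B' : arc_white a n.-1 B -> rule2 setT B B' ->
  exists2 w, ~ zone a n.-1 w & B' = w |: B.
Proof.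
have n0 : 0 < n.-1 by move: n_ge3; lia.
have nE : n.-1.+1 = n by move: n_ge3; lia.
move=> aw /rule2_elim[v [w [[vB _ wB vw ->] uniq_w]]]; exists w => // wz.
have [adja adjb] := adj_ends a n0; rewrite nE iter_ordS_full in adjb.
have vE : v = center a.
  case: wz => [wa|[wl]]; last first.
    by rewrite nE iter_ordS_full => -[] e; rewrite -e; apply: adj_to_leaf vw.
  by have [_] := arc_blue_nbr aw vB vw wa; rewrite nE iter_ordS_full => -[].
have e1 : center (c a 1) = w.
  by apply: uniq_w; rewrite ?inE ?vE //; apply/aw/on_arc_center; rewrite n0.
have e2 : center (c a n.-1) = w.
  by apply: uniq_w; rewrite ?inE ?vE //; apply/aw/on_arc_center; rewrite n0 leqnn.
have : c a 1 = c a n.-1 by rewrite -[LHS]core_center e1 -e2.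
by move/iter_ordS_inj => h; move: n_ge3 h; lia.
Qed.

Hypothesis p_ge2 : forall i : cycle_graph n, 2 <= p i.

(** A star has two leaves, so one token cannot color them both. *)
Lemma leaf_white_token i B v : (forall x, core x = i -> x \notin B) ->
  leaf_white i (v |: B).
Proof.
move=> iB; pose l (h : 'I_2) : G := inr (Tagged _ (widen_ord (p_ge2 i) h)).
have [h hv] : exists h, l h != v.
  have [e|] := eqVneq (l ord0) v; last by exists ord0.
  exists ord_max; rewrite -e; apply/eqP.
  by move/(congr1 (fun x : G => if x is inr m then nat_of_ord (tagged m) else 0)).
by exists (l h); rewrite !inE negb_or hv iB.
Qed.

(** The invariant costs Blue a token per halving of the arc: a token in the star
    of an arc vertex splits the arc there, and the larger part is again guarded
    since that vertex keeps a white leaf; a token on a leaf of an end only makes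
    the arc one vertex shorter. *)
Lemma guarded_arc_bound a j t B : j.+1 < n -> arc_white a j B ->
    leaf_white a B -> leaf_white (c a j.+1) B -> blue_wins 2 t B ->
  j < 2 ^ t.
Proof.
elim/ltn_ind: j a t B => j IHj a t B jn aw aB bB winB.
have [->|j0] := posnP j; first by rewrite expn_gt0.
pose P B := [/\ arc_white a j B, leaf_white a B & leaf_white (c a j.+1) B].
have Padd B1 w : P B1 -> ~ zone a j w -> P (w |: B1).
  move=> [aw1 aB1 bB1] wz; split.
  - by apply: arc_white_add => // wa; apply: wz; left.
  - by apply: leaf_white_add => // -[wl e]; apply: wz; right; split=> //; left.
  - by apply: leaf_white_add => // -[wl e]; apply: wz; right; split=> //; right.
apply: (@blue_wins_trap _ 2 P (fun t => j < 2 ^ t)) winB => //.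
- by case=> /(_ _ (on_arc_center a (k := 1) _)) h; move: h; rewrite inE j0 => /(_ isT).
- move=> B1 B' PB1 BB'; case: (PB1) => aw1 aB1 bB1.
  by have [w wz ->] := force_off_zone j0 aw1 aB1 bB1 BB'; apply: Padd.
- move=> B1 S PB1 SW cS; case: (PB1) => aw1 _ _.
  have [T [TS T0 HT]] := white_reply j0 aw1 SW cS; exists T; split=> // B'.
  by case/HT=> w wz ->; apply: Padd.
move=> {aw aB bB}t1 B1 v PB1 vB winB1 IH; case: (PB1) => aw1 aB1 bB1.
have [vz|/(Padd _ _ PB1)/IH] := pselect (zone a j v); last first.
  by rewrite expnS; lia.
have arcW k : 0 < k <= j -> leaf_white (c a k) (v |: B1).
  by move=> kj; apply: leaf_white_token => x xk; apply: aw1; exists k.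
case: vz => [[k kj vk]|[vl vab]].
  have off i : core v != i -> ~ (is_leaf v /\ core v = i) by move=> /eqP ? [].
  have vNa m h : h + m < n -> (h + m < k \/ k <= h) -> ~ on_arc (c a h) m v.
    by apply: not_on_arc => //; lia.
  have k_a : core v != a.
    by rewrite vk; apply/eqP => /(@iter_ordS_inj a k 0); lia.
  have k_b : core v != c a j.+1.
    by rewrite vk; apply/eqP => /iter_ordS_inj; lia.
  have left_bound : k.-1 < 2 ^ t1.
    apply: (IHj k.-1 _ a t1 (v |: B1)) => //; try by lia.
    - apply: arc_white_add; last by apply: arc_white_sub aw1; lia.
      by apply: (vNa _ 0); lia.
    - by apply: leaf_white_add aB1; apply: off.
    - by case/andP: (kj) => k0 _; rewrite prednK //; apply: arcW.
  have right_bound : j - k < 2 ^ t1.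
    apply: (IHj (j - k) _ (c a k) t1 (v |: B1)) => //; try by lia.
    - apply: arc_white_add; last by apply: arc_white_shift aw1; lia.
      by apply: vNa; lia.
    - exact: arcW.
    - rewrite -iterD (_ : (j - k).+1 + k = j.+1); last by lia.
      by apply: leaf_white_add bB1; apply: off.
  by rewrite expnS; lia.
have vNa : ~ on_arc a j v.
  case=> k kj vk; case: vab; rewrite vk => e.
    by have := @iter_ordS_inj a k 0 _ _ e; lia.
  by have := iter_ordS_inj _ _ e; lia.
have ends_neq : a <> c a j.+1.
  by move/(@iter_ordS_inj a 0 j.+1); lia.
suff : j.-1 < 2 ^ t1 by rewrite expnS; have := expn_gt0 2 t1; lia.
case: vab => e.
  apply: (IHj j.-1 _ (c a 1) t1 (v |: B1)) => //; try by lia.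
  - apply: arc_white_shift (arc_white_add vNa aw1); lia.
  - by apply: arcW; rewrite j0.
  - rewrite -iterD (_ : j.-1.+1 + 1 = j.+1); last by lia.
    by apply: leaf_white_add bB1 => -[_]; rewrite e.
apply: (IHj j.-1 _ a t1 (v |: B1)) => //; try by lia.
- by apply: arc_white_sub (arc_white_add vNa aw1); lia.
- by apply: leaf_white_add aB1 => -[_]; rewrite e => /esym.
- by rewrite prednK //; apply: arcW; rewrite j0 leqnn.
Qed.

(** The opening phase, while every token so far is in the star of [a]: the rest is
    an arc of [n - 1] vertices with both ends at [a], and free moves stay off it. *)
Lemma opening_trap a (P : {set G} -> Prop) (Q : nat -> Prop) :
    (forall B, P B -> arc_white a n.-1 B) ->
    (forall B w, P B -> ~ zone a n.-1 w -> P (w |: B)) ->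
    (forall t B v, P B -> v \notin B -> blue_wins 2 t (v |: B) ->
       (P (v |: B) -> Q t) -> Q t.+1) ->
  forall t B, P B -> blue_wins 2 t B -> Q t.
Proof.
have n0 : 0 < n.-1 by move: n_ge3; lia.
move=> Parc Padd; apply: blue_wins_trap.
- move=> /Parc/(_ _ (on_arc_center a (k := 1) _)); rewrite inE n0.
  by move=> /(_ isT).
- move=> B B' PB /(force_off_zone_full (Parc _ PB))[w wz ->]; exact: Padd.
move=> B S PB SW cS; have [T [TS T0 HT]] := white_reply n0 (Parc _ PB) SW cS.
by exists T; split=> // B' /HT[w wz ->]; apply: Padd.
Qed.

Lemma on_arc_full a x : core x != a -> exists2 k, 0 < k < n & core x = c a k.
Proof.
have [k kn ->] := iter_ordS_onto a (core x); case: k kn => [|k] kn; first by rewrite eqxx.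
by exists k.+1.
Qed.

(** All leaves of [a] may be blue here, so [a] is no end of a guarded arc: the next
    token outside its star leaves arcs that must end at the cycle neighbors of [a],
    [n - 4] vertices in total instead of [n - 2], or a single arc of [n - 3] if
    that token is next to [a]. *)
Lemma opening_bound_spent a t B : arc_white a n.-1 B -> blue_wins 2 t B ->
  0 < t /\ n <= 2 ^ t + 2.
Proof.
move: t B; apply: (@opening_trap a _ (fun t => 0 < t /\ n <= 2 ^ t + 2)) => //.
  by move=> B w aw wz; apply: arc_white_add => // wa; apply: wz; left.
move=> t B v aw vB winB IH; split=> //.
have [va|va] := eqVneq (core v) a.
  have /IH[_] : arc_white a n.-1 (v |: B).
    apply: arc_white_add aw => -[k kn]; rewrite va => e.
    by have := @iter_ordS_inj a 0 k _ _ e; lia.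
  by rewrite expnS; lia.
have [k kn vk] := on_arc_full va.
have star m : 0 < m < n -> leaf_white (c a m) (v |: B).
  by move=> mn; apply: leaf_white_token => x xm; apply: aw; exists m; rewrite // ; lia.
have vNa m h := @not_on_arc a m h k v vk (proj2 (andP kn)).
have left_bound : 1 < k -> k - 2 < 2 ^ t.
  move=> k1; apply: (@guarded_arc_bound (c a 1) (k - 2) t (v |: B)) => //; try by lia.
  - apply: arc_white_add; last by apply: arc_white_shift aw; lia.
    by apply: vNa; lia.
  - by apply: star; lia.
  - by rewrite -iterD; apply: star; lia.
have right_bound : k < n.-1 -> n - 2 - k < 2 ^ t.
  move=> k1; apply: (@guarded_arc_bound (c a k) (n - 2 - k) t (v |: B)) => //; try by lia.
  - apply: arc_white_add; last by apply: arc_white_shift aw; lia.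
    by apply: vNa; lia.
  - by apply: star; lia.
  - by rewrite -iterD; apply: star; lia.
have := expn_gt0 2 t; rewrite expnS.
have [k1|k1] := leqP k 1; first by move: right_bound; lia.
by have [k2|k2] := leqP n.-1 k; move: left_bound right_bound; lia.
Qed.

(** A token outside the star of [a] leaves two arcs that are guarded because [a]
    has a white leaf.  If instead the leaf of [a] is spent, the weaker bound of
    [opening_bound_spent] suffices: a token is gone and another one is needed. *)
Lemma opening_bound a t B : arc_white a n.-1 B -> leaf_white a B ->
  blue_wins 2 t B -> n <= 2 ^ t.
Proof.
move=> aw aB winB.
pose P B := arc_white a n.-1 B /\ leaf_white a B.
apply: (@opening_trap a P (fun t => n <= 2 ^ t)) winB => //.
- by move=> B1 [].
- move=> B1 w [aw1 aB1] wz; split.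
    by apply: arc_white_add => // wa; apply: wz; left.
  by apply: leaf_white_add => // -[wl e]; apply: wz; right; split=> //; left.
move=> {aw aB}t1 B1 v [aw aB] vB winB1 _.
have [va|va] := eqVneq (core v) a.
  have aw' : arc_white a n.-1 (v |: B1).
    apply: arc_white_add aw => -[k kn]; rewrite va => e.
    by have := @iter_ordS_inj a 0 k _ _ e; lia.
  have [t0 bound] := opening_bound_spent aw' winB1.
  by case: t1 t0 bound {winB1} => // t1 _; rewrite !expnS; have := expn_gt0 2 t1; lia.
have [k kn vk] := on_arc_full va.
have star m : 0 < m < n -> leaf_white (c a m) (v |: B1).
  by move=> mn; apply: leaf_white_token => x xm; apply: aw; exists m; rewrite // ; lia.
have aB' : leaf_white a (v |: B1) by apply: leaf_white_add aB => -[_ e]; rewrite e eqxx in va.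
have vNa m h := @not_on_arc a m h k v vk (proj2 (andP kn)).
have left_bound : k.-1 < 2 ^ t1.
  apply: (@guarded_arc_bound a k.-1 t1 (v |: B1)) => //; try by lia.
  - apply: arc_white_add; last by apply: arc_white_sub aw; lia.
    by apply: (vNa _ 0); lia.
  - by apply: star; lia.
have right_bound : n.-1 - k < 2 ^ t1.
  apply: (@guarded_arc_bound (c a k) (n.-1 - k) t1 (v |: B1)) => //; try by lia.
  - apply: arc_white_add; last by apply: arc_white_shift aw; lia.
    by apply: vNa; lia.
  - exact: star.
  - by rewrite -iterD (_ : _ + k = n) ?iter_ordS_full //; lia.
by rewrite expnS; lia.
Qed.

(** With no blue vertex nothing can force, so the first move is a token. *)
Lemma blue_wins_lower t : blue_wins 2 t (set0 : {set G}) ->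
  exists2 s, t = s.+1 & n <= 2 ^ s.
Proof.
move E : (set0 : {set G}) => B winB; case: winB E => {t B} //.
- move=> t; have n0 : 0 < n by exact: leq_trans n_ge3.
  by move/setP/(_ (center (Ordinal n0))); rewrite !inE.
- move=> t B v _ winB E; exists t => //; apply: (opening_bound (a := core v)) winB.
    apply: arc_white_add => [[k kn]|x _]; last by rewrite -E inE.
    by move=> e; have := @iter_ordS_inj (core v) 0 k _ _ e; lia.
  by apply: leaf_white_token => x _; rewrite -E inE.
- move=> t B B' + _ E; case/rule2_elim=> v [w [[]]]; by rewrite -E inE.
move=> t B S next _ cS nextP _ E.
have S0 : S != set0 by rewrite -card_gt0; apply: leq_trans cS.
have [v [w [[]]]] := rule2_elim (nextP S (subxx S) S0).
by rewrite -E inE.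
Qed.

(** * Blue's strategy *)

Lemma rule2_leaf (U B : {set G}) x : is_leaf x -> center (core x) \in B -> center (core x) \in U ->
    x \in U -> x \notin B ->
    (forall y, y \in U -> y \notin B -> core y = core x -> y = x) ->
    (forall i, cycle_adj (core x) i -> center i \in U -> center i \in B) ->
  rule2 U B (x |: B).
Proof.
move=> xl cB cU xU xB uniq_x cycB.
apply: (@rule2_intro _ _ _ (center (core x))) => //; first by rewrite adj_center_leaf.
move=> y yU yB; have [yl|/nonleafE yE] := boolP (is_leaf y).
  by rewrite adj_center_leaf // => /eqP e; apply: uniq_x.
rewrite yE adj_centers => /cycB; rewrite -yE => /(_ yU) yB'.
by rewrite yB' in yB.
Qed.

(** A vertex with a single white leaf forces it, so in each star Blue pays for all
    white leaves but one. *)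
Lemma pay_for_leaves t B : (forall i, center i \in B) ->
  #|~: B| <= t + #|core @: (~: B)| -> blue_wins 2 t B.
Proof.
move E : #|~: B| => m; elim: m t B E => [|m IHm] t B E cB le_t.
  by rewrite (_ : B = setT); [apply: BlueDone | rewrite -[B]setCK (cards0_eq E) setC0].
have /card_gt0P[x] : 0 < #|~: B| by rewrite E.
rewrite inE => xB.
have leaf_of y : y \notin B -> is_leaf y.
  by move=> yB; apply: contraT => /nonleafE yE; rewrite yE cB in yB.
have setCx : ~: (x |: B) = (~: B) :\ x by apply/setP=> y; rewrite !inE negb_or.
have card' : #|~: (x |: B)| = m by apply: succn_inj; rewrite -E -(card_setCU1 xB).
have cB' i : center i \in x |: B by rewrite inE cB orbT.
have img : core @: (~: B) \subset core x |: core @: (~: (x |: B)).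
  apply/subsetP=> i /imsetP[y yB ->]; have [->|yx] := eqVneq y x; first by rewrite setU11.
  by rewrite setCx inE imset_f ?orbT // !inE yx -in_setC.
have [/existsP[y /and3P[yB yx /eqP exy]]|/existsPn uniq_x] :=
    boolP [exists y, [&& y \notin B, y != x & core y == core x]].
  have img' : core @: (~: B) \subset core @: (~: (x |: B)).
    apply: subset_trans img _; rewrite subUset subxx andbT sub1set -exy setCx.
    by apply: imset_f; rewrite !inE yx.
  case: t le_t => [|t] le_t.
    suff : #|core @: (~: B)| <= m by move: le_t; lia.
    by apply: leq_trans (subset_leq_card img') _; rewrite -card' leq_imset_card.
  apply: (BlueToken xB); apply: IHm => //.
  by have := subset_leq_card img'; lia.
apply: (@BlueForce _ _ _ _ (x |: B)).
  apply: rule2_leaf; rewrite ?inE //; first exact: leaf_of.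
  move=> y _ yB exy; apply/eqP; apply: contraT => yx.
  by have := uniq_x y; rewrite yB yx exy eqxx.
apply: IHm => //; have := subset_leq_card img; rewrite cardsU1; lia.
Qed.

(** Three white leaves at distinct centers may be announced together: whichever
    of them White returns, each center sees at most one of them. *)
Lemma finish_leaves k t B : (forall i, p i <= k) -> 2 * k - 2 <= t ->
  (forall i, center i \in B) -> blue_wins 2 t B.
Proof.
move=> pk kt; move E : #|~: B| => m; elim/ltn_ind: m B E => m IHm B E cB.
have [le2|] := leqP #|core @: (~: B)| 2.
  apply: pay_for_leaves => //.
  have fiber i : #|[set x in ~: B | core x == i]| <= k.
    pose l (h : 'I_(p i)) : G := inr (Tagged _ h).
    apply: leq_trans (pk i); rewrite -[X in _ <= X]card_ord -cardsT.
    apply: leq_trans (leq_imset_card l _); apply/subset_leq_card/subsetP=> -[j|[j h]].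
      by rewrite !inE cB.
    by rewrite !inE /= => /andP[_ /eqP e]; subst j; apply: imset_f; rewrite inE.
  have : #|~: B| <= #|core @: (~: B)| * k.
    rewrite -sum1_card (partition_big core (mem (core @: (~: B)))) /=; last first.
      by move=> x xB; apply: imset_f.
    rewrite -sum_nat_const; apply: leq_sum => i _.
    by apply: leq_trans (fiber i); rewrite -sum1_card; apply/eq_leq/eq_bigl => x; rewrite inE.
  by move: le2; case: #|core @: (~: B)| => [|[|[|]]] //; nia.
case/card_gt2P=> i [j [h [[/imsetP[x xB ->] /imsetP[y yB ->] /imsetP[z zB ->]] [xy yz zx]]]].
rewrite !inE in xB yB zB.
have leaf_of u : u \notin B -> is_leaf u.
  by move=> uB; apply: contraT => /nonleafE uE; rewrite uE cB in uB.
have compE u : u \notin B -> white_comp B u = [set u].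
  by move=> uB; rewrite leaf_white_comp ?leaf_of ?cB.
have inS u : u \notin B -> [set u] \in white_components B.
  by move=> uB; rewrite -compE //; apply: white_comp_in.
have neq u v : core u != core v -> [set u] != [set v] :> {set G}.
  by apply: contraNneq => /set1_inj->.
apply: (@blue_wins_announce _ _ _ _ [set [set x]; [set y]; [set z]]).
- by apply/subsetP=> C; rewrite !inE -orbA => /or3P[] /eqP->; apply: inS.
- by rewrite card_setU3 ?neq.
move=> T /subsetP TS /set0Pn[C CT].
have [u [CE uxyz]] : exists u, C = [set u] /\ (u \in [:: x; y; z]).
  by move: (TS C CT); rewrite !inE -orbA => /or3P[] /eqP->;
    [exists x|exists y|exists z]; rewrite !inE eqxx ?orbT.
subst C; have uB : u \notin B.
  by move: uxyz; rewrite !inE => /or3P[] /eqP->.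
exists (u |: B).
  apply: rule2_leaf; rewrite ?inE ?cB ?leaf_of //=.
    by apply/orP; right; apply/bigcupP; exists [set u]; rewrite ?set11.
  move=> v; rewrite inE => /orP[-> //|/bigcupP[D DT vD]] _.
  have vxyz : v \in [:: x; y; z].
    by move: (TS D DT) vD; rewrite !inE -orbA => /or3P[] /eqP->; rewrite inE => ->; rewrite ?orbT.
  move: uxyz vxyz xy yz zx; rewrite !inE.
  by case/or3P=> /eqP-> /or3P[] /eqP-> // xy yz zx e;
    move: xy yz zx; rewrite e ?eqxx.
apply: (IHm _ _ (u |: B) erefl) => [|i']; last by rewrite inE cB orbT.
by rewrite -E -(card_setCU1 uB).
Qed.

Lemma center_inj : injective center.
Proof. by move=> i i' []. Qed.

Lemma center_in_add (i w : 'I_n) B :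
  (center i \in center w |: B) = (nat_of_ord i == w) || (center i \in B).
Proof. by rewrite inE inE (inj_eq center_inj). Qed.

Lemma cycle_adj_nat i i' : cycle_adj i i' ->
  [\/ i' = i.+1 :> nat, i = i'.+1 :> nat, i = 0 :> nat /\ i' = n.-1 :> nat
    | i' = 0 :> nat /\ i = n.-1 :> nat].
Proof.
have ordSE (h : 'I_n) : nat_of_ord (ordS h) = if h.+1 == n then 0 else h.+1.
  case: eqP => [e|ne]; first by rewrite /= e modnn.
  by rewrite /= modn_small //; have := ltn_ord h; lia.
case/cycle_adjP => /(congr1 (@nat_of_ord n)); rewrite ordSE; case: eqP => e h.
- by constructor 4; lia.
- by constructor 1.
- by constructor 3; lia.
- by constructor 2.
Qed.

Definition between (l r : nat) x : bool := l < core x < r.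

Lemma white_comp_between (l r : 'I_n) B y z : center l \in B -> center r \in B ->
  between l r y -> z \in white_comp B y -> between l r z.
Proof.
move=> lB rB yb; rewrite inE; apply: (@connect_closed _ B (between l r)) => // u v ub _ vB uv.
have [e|ne] := eqVneq (core u) (core v); first by rewrite /between -e.
have [_ vE /cycle_adj_nat uv'] := adj_core_neq uv ne.
have vl : core v != l by apply: contraNneq vB => e; rewrite vE e.
have vr : core v != r by apply: contraNneq vB => e; rewrite vE e.
move: vl vr ub (ltn_ord r); rewrite -!val_eqE /between /=.
by case: uv'; lia.
Qed.

(** Membership facts are Boolean atoms, on which [lia] would split cases. *)
Ltac nat_lia :=
  repeat match goal with
  | H : is_true (_ \in _) |- _ => clear H
  | H : is_true (_ \notin _) |- _ => clear H
  | H : is_true (is_leaf _) |- _ => clear H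
  end; lia.

(** With two white arcs, on the two sides of the blue segment from [m] to [m'],
    Blue never needs a token: she announces both arcs and a leaf of [l].  If White
    returns the right arc, [r] forces into it; if he returns only the left arc,
    [m] does; if only the leaf, [l] forces it.  A leafless [l] forces on its own.
    White decides which arc survives, so Blue can only rely on both being short. *)
Lemma two_arcs_win t N :
    (forall (l r : 'I_n) B, l < r -> r - l <= N ->
       (forall i, (center i \in B) = ~~ (l < i < r)) -> blue_wins 2 t B) ->
  forall (l m m' r : 'I_n) B, l < m <= m' -> m' < r -> m - l <= N -> r - m' <= N ->
    (forall i, (center i \in B) = ~~ ((l < i < m) || (m' < i < r))) ->
  blue_wins 2 t B.
Proof.
move=> win1 l m m' r B; move E : #|~: B| => c.
elim/ltn_ind: c l m r B E => c IHc l m r B E lm mr lN rN cB.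
have [lm1|lm1] := eqVneq (m : nat) l.+1.
  by apply: (win1 m' r) => // i; rewrite cB; nat_lia.
have [rm1|rm1] := eqVneq (r : nat) m'.+1.
  by apply: (win1 l m); [nat_lia | nat_lia |] => i; rewrite cB; nat_lia.
have step w (l1 m1 r1 : 'I_n) : w \notin B -> l1 < m1 <= m' -> m' < r1 ->
    m1 - l1 <= N -> r1 - m' <= N ->
    (forall i, (center i \in w |: B) = ~~ ((l1 < i < m1) || (m' < i < r1))) ->
    blue_wins 2 t (w |: B).
  move=> wB *; apply: (IHc _ _ l1 m1 r1 (w |: B) erefl) => //.
  by rewrite -E -(card_setCU1 wB).
have [ls lsE] : exists i : 'I_n, i = l.+1 :> nat.
  have ls : l.+1 < n by have := ltn_ord m; nat_lia.
  by exists (Ordinal ls).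
have [mp mpE] : exists i : 'I_n, i = m.-1 :> nat.
  have mp : m.-1 < n by have := ltn_ord m; nat_lia.
  by exists (Ordinal mp).
have [rp rpE] : exists i : 'I_n, i = r.-1 :> nat.
  have rp : r.-1 < n by have := ltn_ord r; nat_lia.
  by exists (Ordinal rp).
have lsB : center ls \notin B by rewrite cB; nat_lia.
have mpB : center mp \notin B by rewrite cB; nat_lia.
have rpB : center rp \notin B by rewrite cB; nat_lia.
have stepl : blue_wins 2 t (center ls |: B).
  apply: (step _ ls m r) => //; try nat_lia.
  by move=> i; rewrite center_in_add cB; nat_lia.
have stepm : blue_wins 2 t (center mp |: B).
  apply: (step _ l mp r) => //; try nat_lia.
  by move=> i; rewrite center_in_add cB; nat_lia.
have stepr : blue_wins 2 t (center rp |: B).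
  apply: (step _ l m rp) => //; try nat_lia.
  by move=> i; rewrite center_in_add cB; nat_lia.
have lB : center l \in B by rewrite cB; nat_lia.
have mB : center m \in B by rewrite cB; nat_lia.
have m'B : center m' \in B by rewrite cB; nat_lia.
have rB : center r \in B by rewrite cB; nat_lia.
have adjI (i j : 'I_n) : j = i.+1 :> nat -> adj (center i) (center j).
  move=> e; have -> : j = ordS i; last exact: cycle_adjS.
  by apply/ord_inj; rewrite /= modn_small -?e.
have [/existsP[x /and3P[xl /eqP xc xB]]|/existsPn noleaf] :=
    boolP [exists x, [&& is_leaf x, core x == l & x \notin B]]; last first.
  apply: BlueForce stepl; apply: (@rule2_intro _ _ _ (center l)) => //.
    exact: adjI.
  move=> y _ yB; have [yl|/nonleafE yE] := boolP (is_leaf y).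
    rewrite adj_center_leaf // => /eqP e.
    by have := noleaf y; rewrite yl yB e eqxx.
  move: yB; rewrite yE adj_centers cB => yB /cycle_adj_nat ly; congr center.
  apply/ord_inj; move: yB ly; rewrite lsE.
  by have := ltn_ord r; move=> ? ? []; nat_lia.
set W1 := white_comp B (center mp); set W2 := white_comp B (center rp).
have W1b y : y \in W1 -> between l m y.
  by apply: white_comp_between => //; rewrite /between /=; nat_lia.
have W2b y : y \in W2 -> between m' r y.
  by apply: white_comp_between => //; rewrite /between /=; nat_lia.
have W12 : W1 != W2.
  apply/eqP=> e; have := W2b (center mp); rewrite -e mem_white_comp /between /=.
  by move/(_ isT); nat_lia.
have W2x : W2 != [set x].
  apply/eqP=> e; have := W2b x; rewrite e set11 /between xc.
  by move/(_ isT); nat_lia.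
have xW1 : [set x] != W1.
  apply/eqP=> e; have := W1b x; rewrite -e set11 /between xc.
  by move/(_ isT); nat_lia.
apply: (@blue_wins_announce _ _ _ _ [set W1; W2; [set x]]).
- apply/subsetP=> C; rewrite !inE -orbA => /or3P[] /eqP->; try exact: white_comp_in.
  suff <- : white_comp B x = [set x] by exact: white_comp_in.
  by rewrite leaf_white_comp // xc lB.
- by rewrite card_setU3.
move=> T /subsetP TS T0.
have whiteT y : y \in B :|: cover T -> y \notin B ->
    [\/ W1 \in T /\ between l m y, W2 \in T /\ between m' r y | y = x].
  rewrite inE => /orP[-> //|/bigcupP[C CT yC]] _.
  move: (TS C CT) (CT) yC; rewrite !inE -orbA => /or3P[] /eqP-> DT.
  - by move/W1b=> yb; constructor 1.
  - by move/W2b=> yb; constructor 2.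
  - by move/set1P=> ->; constructor 3.
have inU y C : C \in T -> y \in C -> y \in B :|: cover T.
  by move=> CT yC; rewrite inE; apply/orP; right; apply/bigcupP; exists C.
have forceT (i w : 'I_n) C : center i \in B -> C \in T -> center w \in C ->
    center w \notin B -> l < i -> adj (center i) (center w) ->
    (forall y, y \in B :|: cover T -> y \notin B -> between l r y ->
      core y != i /\ (cycle_adj i (core y) -> core y = w :> nat)) ->
    rule2 (B :|: cover T) B (center w |: B).
  move=> iB CT wC wB li iw uniq_w; apply: (@rule2_intro _ _ _ (center i)) => //.
  - by rewrite inE iB.
  - exact: inU wC.
  move=> y yU yB; have [->|yx] := eqVneq y x.
    by rewrite adj_center_leaf // xc => /eqP e; rewrite e ltnn in li.
  have yb : between l r y.
    case: (whiteT y yU yB) => [[_]|[_]|e]; rewrite /between; try nat_lia.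
    by rewrite e eqxx in yx.
  have [yi yw] := uniq_w y yU yB yb.
  have [yl|/nonleafE yE] := boolP (is_leaf y).
    by rewrite adj_center_leaf // eq_sym (negPf yi).
  by rewrite yE adj_centers => /yw e; congr center; apply: ord_inj.
have [W2T|W2T] := boolP (W2 \in T).
  exists (center rp |: B) => //; apply: (forceT r rp W2) => //.
  - exact: mem_white_comp.
  - by nat_lia.
  - by rewrite adj_sym; apply: adjI; nat_lia.
  move=> y _ _; rewrite -val_eqE /between /= => yb; split; first by nat_lia.
  by case/cycle_adj_nat; have := ltn_ord r; nat_lia.
have [W1T|W1T] := boolP (W1 \in T).
  exists (center mp |: B) => //; apply: (forceT m mp W1) => //.
  - exact: mem_white_comp.
  - by nat_lia.
  - by rewrite adj_sym; apply: adjI; nat_lia.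
  move=> y yU yB yb.
  have {}yb : between l m y.
    case: (whiteT y yU yB) => [[] //|[]|e]; first by rewrite (negPf W2T).
    by move: yb; rewrite /between e xc ltnn.
  move: yb; rewrite -val_eqE /between /= => yb; split; first by nat_lia.
  by case/cycle_adj_nat; have := ltn_ord m; nat_lia.
have xT : [set x] \in T.
  have [C CT] := set0Pn _ T0; move: (TS C CT) (CT); rewrite !inE -orbA.
  by case/or3P=> /eqP-> //; rewrite ?(negPf W1T) ?(negPf W2T).
exists (x |: B); last first.
  apply: (step _ l m r) => // i; rewrite -cB in_setU1.
  by case: eqP => // e; rewrite -e in xl.
apply: rule2_leaf => //; rewrite ?xc ?inE ?lB //.
- by apply/orP; right; apply/bigcupP; exists [set x]; rewrite ?set11.
- move=> y yU yB _; case: (whiteT y yU yB) => [[]|[]|] //.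
    by rewrite (negPf W1T).
  by rewrite (negPf W2T).
move=> i _; rewrite inE => /orP[//|/bigcupP[C CT iC]].
move: (TS C CT); rewrite !inE -orbA => /or3P[] /eqP e; rewrite e in CT iC.
- by rewrite (negPf W1T) in CT.
- by rewrite (negPf W2T) in CT.
by move: iC; rewrite inE => /eqP ix; rewrite -ix in xl.
Qed.

(** A token in the middle of the white arc halves the arc that White can keep. *)
Lemma one_arc_win k s t (l r : 'I_n) B : (forall i, p i <= k) ->
    s + (2 * k - 2) <= t -> l < r -> r - l <= 2 ^ s ->
    (forall i, (center i \in B) = ~~ (l < i < r)) ->
  blue_wins 2 t B.
Proof.
move=> pk; elim: s t l r B => [|s IHs] t l r B st lr lrN cB.
  by apply: (finish_leaves pk) => [|i]; [lia | rewrite cB; lia].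
have [lr1|lr1] := eqVneq (r : nat) l.+1.
  by apply: (finish_leaves pk) => [|i]; [lia | rewrite cB; lia].
have [m mE] : exists i : 'I_n, i = (l + r)./2 :> nat.
  have mn : (l + r)./2 < n by have := ltn_ord r; lia.
  by exists (Ordinal mn).
rewrite expnS in lrN; case: t st => // t st.
apply: (@BlueToken _ _ _ _ (center m)); first by rewrite cB mE; lia.
apply: (@two_arcs_win t (2 ^ s) _ l m m r); try lia.
  by move=> l1 r1 B1; apply: IHs; lia.
by move=> i; rewrite center_in_add cB; lia.
Qed.

Lemma blue_wins_upper k t : (forall i, p i <= k) -> 0 < k ->
  trunc_log 2 (n - 2) + 2 * k + 1 <= t -> blue_wins 2 t (set0 : {set G}).
Proof.
move=> pk k0; case: t => [|[|t]] tk; try lia.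
have n0 : 0 < n by lia.
have n1 : n.-1 < n by lia.
apply: (@BlueToken _ _ _ _ (center (Ordinal n0))); first by rewrite inE.
apply: (@BlueToken _ _ _ _ (center (Ordinal n1))).
  by rewrite !inE orbF (inj_eq center_inj) -val_eqE /=; lia.
apply: (@one_arc_win k (trunc_log 2 (n - 2)).+1 t (Ordinal n0) (Ordinal n1)) => //=; try lia.
  by have := @trunc_log_ltn 2 (n - 2) isT; lia.
by move=> i; rewrite !center_in_add inE /=; have := ltn_ord i; lia.
Qed.

End PendantCycle.

Local Open Scope ring_scope.

Theorem theorem4p9 (R : realType) (k n : nat) (hk : (2 <= k)%N) (hn : (3 <= n)%N)
    (p : cycle_graph n -> nat) (hp : forall i, (2 <= p i <= k)%N) :
  log2 (n%:R : R) + 1 <= (Zq (attach_pendants p) 2)%:R :> R /\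
  (Zq (attach_pendants p) 2)%:R <= log2 (n%:R - 2%:R : R) + 2%:R * k%:R + 1 :> R.
Proof.
have ln2 : 0 < ln 2 :> R by rewrite ln_gt0 // ltr1n.
have p_ge2 i : (1 < p i)%N by case/andP: (hp i).
have p_lek i : (p i <= k)%N by case/andP: (hp i).
rewrite /Zq; case: ex_minnP => z /asboolP zwin zmin; split.
  have [s -> ns] := blue_wins_lower hn p_ge2 zwin.
  rewrite -natr1 lerD2r /log2 ler_pdivrMr // mulr_natl -lnXn ?ltr0n //.
  rewrite ler_ln ?posrE ?exprn_gt0 ?ltr0n //; last exact: leq_trans hn.
  by rewrite -natrX ler_nat.
have n2 : (0 < n - 2)%N by rewrite subn_gt0.
have /zmin zle : `[< blue_wins 2 (trunc_log 2 (n - 2) + 2 * k + 1)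
                       (set0 : {set attach_pendants p}) >].
  by apply/asboolP; apply: (blue_wins_upper hn p_lek) => //; exact: leq_trans hk.
apply: (@le_trans _ _ (trunc_log 2 (n - 2) + 2 * k + 1)%N%:R); first by rewrite ler_nat.
rewrite natrD natrD natrM !lerD2r -natrB ?(ltnW hn) // /log2 ler_pdivlMr //.
rewrite mulr_natl -lnXn ?ltr0n // ler_ln ?posrE ?exprn_gt0 ?ltr0n //.
by rewrite -natrX ler_nat trunc_logP.
Qed.
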